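(* Let $F$ be a field of characteristic $p\neq 0$ and let $n>1$. Then there exists an $F$-algebra homomorphism $\varphi: A_n\to A_n$ of the Weyl algebra $A_n$ over $F$ to itself which is not injective.
   Context: For $n\ge 1$ the Weyl algebra $A_n$ over $F$ is the associative unital $F$-algebra generated by $2n$ elements $x_1,\ldots,x_n,y_1,\ldots,y_n$ subject to the relations $[x_i,y_j]=\delta_{ij}$, $[x_i,x_j]=0$, $[y_i,y_j]=0$ for $1\le i,j\le n$, where $[a,b]=ab-ba$ and $\delta_{ij}$ is the Kronecker symbol. Homomorphisms are unital and $F$-linear. *)

(* Defs.v *)
From HB Require Import structures.
From mathcomp Require Import all_boot all_algebra.
From mathcomp Require Import mpoly.
From mathcomp Require Import monalg.
From mathcomp Require Import boolp generic_quotient ring_quotient.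

Set Implicit Arguments.
Unset Strict Implicit.
Unset Printing Implicit Defensive.

Import GRing.Theory.
Local Open Scope ring_scope.
Local Open Scope quotient_scope.

Definition commutator (R : nzRingType) (a b : R) : R := a * b - b * a.

(* The two-sided ideal of R generated by S; closure under opposites follows
   from multiplication by -1. *)
Inductive two_sided_ideal (R : nzRingType) (S : R -> Prop) : R -> Prop :=
| Ideal_gen r : S r -> two_sided_ideal S r
| Ideal_zero : two_sided_ideal S 0
| Ideal_add a b :
    two_sided_ideal S a -> two_sided_ideal S b -> two_sided_ideal S (a + b)
| Ideal_mull a b : two_sided_ideal S b -> two_sided_ideal S (a * b)
| Ideal_mulr a b : two_sided_ideal S a -> two_sided_ideal S (a * b).

Section IdealQuotient.
Variables (F : fieldType) (A : algType F) (S : A -> Prop).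

Definition ideal_pred : {pred A} := fun a => `[< two_sided_ideal S a >].

Lemma ideal_predP a : reflect (two_sided_ideal S a) (a \in ideal_pred).
Proof. exact: asboolP. Qed.

Lemma ideal_predMl a b : b \in ideal_pred -> a * b \in ideal_pred.
Proof. by move=> /ideal_predP Ib; apply/ideal_predP/Ideal_mull. Qed.

Lemma ideal_predMr a b : a \in ideal_pred -> a * b \in ideal_pred.
Proof. by move=> /ideal_predP Ia; apply/ideal_predP/Ideal_mulr. Qed.

Lemma ideal_pred_zmod_closed : zmod_closed ideal_pred.
Proof.
split=> [|a b /ideal_predP Ia Ib]; apply/ideal_predP; first exact: Ideal_zero.
by apply: Ideal_add Ia _; rewrite -mulN1r; apply/ideal_predP/ideal_predMl.
Qed.
HB.instance Definition _ :=
  GRing.isZmodClosed.Build A ideal_pred ideal_pred_zmod_closed.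

(* The quotient of A by the two-sided ideal generated by S. The argument
   records that this ideal is proper, since an algType is a nonzero ring. *)
Definition alg_quot of ~ two_sided_ideal S 1 : Type :=
  Quotient.quot ideal_pred.

Variable S_proper : ~ two_sided_ideal S 1.
Local Notation Q := (alg_quot S_proper).

HB.instance Definition _ := GRing.Zmodule.copy Q (Quotient.quot ideal_pred).
HB.instance Definition _ :=
  EqQuotient.copy Q (Quotient.quot ideal_pred).

Definition quot_pi (a : A) : Q := \pi_(Quotient.quot ideal_pred) a.
Definition quot_repr (u : Q) : A := repr (u : Quotient.quot ideal_pred).

Lemma quot_reprK : cancel quot_repr quot_pi.
Proof. exact: reprK. Qed.

Lemma quot_piP a b : reflect (quot_pi a = quot_pi b) (a - b \in ideal_pred).
Proof. by rewrite Quotient.idealrBE; apply: eqP. Qed.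

Lemma quot_pi_repr a : quot_repr (quot_pi a) - a \in ideal_pred.
Proof. by apply/quot_piP; rewrite quot_reprK. Qed.

Lemma quot_piB : zmod_morphism quot_pi.
Proof.
move=> a b; apply: (etrans (Quotient.pi_add _ _ _)).
by congr (_ + _); apply: Quotient.pi_opp.
Qed.
HB.instance Definition _ := GRing.isZmodMorphism.Build A Q quot_pi quot_piB.

Definition quot_one : Q := quot_pi 1.
Definition quot_mul (u v : Q) : Q := quot_pi (quot_repr u * quot_repr v).
Definition quot_scale (c : F) (u : Q) : Q := quot_pi (c *: quot_repr u).

Lemma quot_piM a b : quot_mul (quot_pi a) (quot_pi b) = quot_pi (a * b).
Proof.
apply/quot_piP; set a' := quot_repr _; set b' := quot_repr _.
have -> : a' * b' - a * b = (a' - a) * b' + a * (b' - b).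
  by rewrite mulrBl mulrBr addrA subrK.
by apply: rpredD; [apply: ideal_predMr|apply: ideal_predMl]; apply: quot_pi_repr.
Qed.

Lemma quot_piZ c a : quot_scale c (quot_pi a) = quot_pi (c *: a).
Proof.
apply/quot_piP; rewrite -scalerBr -mulr_algl.
exact/ideal_predMl/quot_pi_repr.
Qed.

Lemma quot_mulA : associative quot_mul.
Proof.
move=> u v w; rewrite -[u]quot_reprK -[v]quot_reprK -[w]quot_reprK.
by rewrite !quot_piM mulrA.
Qed.

Lemma quot_mul1 : left_id quot_one quot_mul.
Proof. by move=> u; rewrite -[u]quot_reprK quot_piM mul1r. Qed.

Lemma quot_mulr1 : right_id quot_one quot_mul.
Proof. by move=> u; rewrite -[u]quot_reprK quot_piM mulr1. Qed.

Lemma quot_mulDl : left_distributive quot_mul +%R.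
Proof.
move=> u v w; rewrite -[u]quot_reprK -[v]quot_reprK -[w]quot_reprK.
by rewrite -raddfD !quot_piM mulrDl raddfD.
Qed.

Lemma quot_mulDr : right_distributive quot_mul +%R.
Proof.
move=> u v w; rewrite -[u]quot_reprK -[v]quot_reprK -[w]quot_reprK.
by rewrite -raddfD !quot_piM mulrDr raddfD.
Qed.

Lemma quot_one_neq0 : quot_one != 0.
Proof.
apply/eqP; rewrite -(raddf0 quot_pi) => /quot_piP.
by rewrite subr0 => /ideal_predP.
Qed.

HB.instance Definition _ := GRing.Zmodule_isNzRing.Build Q
  quot_mulA quot_mul1 quot_mulr1 quot_mulDl quot_mulDr quot_one_neq0.

Lemma quot_scaleA c d u : quot_scale c (quot_scale d u) = quot_scale (c * d) u.
Proof. by rewrite -[u]quot_reprK !quot_piZ scalerA. Qed.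

Lemma quot_scale1 : left_id 1 quot_scale.
Proof. by move=> u; rewrite -[u]quot_reprK quot_piZ scale1r. Qed.

Lemma quot_scaleDr : right_distributive quot_scale +%R.
Proof.
move=> c u v; rewrite -[u]quot_reprK -[v]quot_reprK.
by rewrite -raddfD !quot_piZ scalerDr raddfD.
Qed.

Lemma quot_scaleDl u : {morph quot_scale^~ u : c d / c + d}.
Proof. by move=> c d; rewrite -[u]quot_reprK !quot_piZ scalerDl raddfD. Qed.

HB.instance Definition _ := GRing.Zmodule_isLmodule.Build F Q
  quot_scaleA quot_scale1 quot_scaleDr quot_scaleDl.

Lemma quot_scaleAl c (u v : Q) : c *: (u * v) = (c *: u) * v.
Proof.
rewrite -[u]quot_reprK -[v]quot_reprK.
by rewrite /GRing.mul /GRing.scale /= !(quot_piZ, quot_piM) scalerAl.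
Qed.
HB.instance Definition _ := GRing.Lmodule_isLalgebra.Build F Q quot_scaleAl.

Lemma quot_scaleAr c (u v : Q) : c *: (u * v) = u * (c *: v).
Proof.
rewrite -[u]quot_reprK -[v]quot_reprK.
by rewrite /GRing.mul /GRing.scale /= !(quot_piZ, quot_piM) scalerAr.
Qed.
HB.instance Definition _ := GRing.Lalgebra_isAlgebra.Build F Q quot_scaleAr.

Lemma quot_pi_monoid_morphism : monoid_morphism quot_pi.
Proof. by split=> // a b; rewrite -quot_piM. Qed.
HB.instance Definition _ :=
  GRing.isMonoidMorphism.Build A Q quot_pi quot_pi_monoid_morphism.

Lemma quot_pi_scalable : scalable quot_pi.
Proof. by move=> c a; rewrite -quot_piZ. Qed.
HB.instance Definition _ :=
  GRing.isScalable.Build F A Q *:%R quot_pi quot_pi_scalable.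

End IdealQuotient.

Section WeylAlgebra.
Variables (F : fieldType) (n : nat).

(* The free unital associative F-algebra on 2n letters: the monoid algebra of
   the free monoid of words in the letters inl i (for x_i) and inr i (for y_i),
   with i ranging over 0, ..., n - 1. *)
Definition free_alg := {malg F[{fmonom ('I_n + 'I_n)%type}]}.

HB.instance Definition _ := GRing.Lalgebra.on free_alg.

Lemma free_scaleAr c (a b : free_alg) : c *: (a * b) = a * (c *: b).
Proof.
have cC : c%:MP * a = a * c%:MP.
  rewrite malgM_def [RHS]malgM_def fgmulUg fgmulgU; apply: eq_bigr => w _.
  by rewrite mul1m mulm1 mulrC.
rewrite -(mul_malgC c b) -(mul_malgC c (a * b)).
apply: (etrans (mulrA _ _ _)); apply: esym; apply: (etrans (mulrA _ _ _)).
exact: (congr1 ( *%R^~ b) (esym cC)).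
Qed.
HB.instance Definition _ := GRing.Lalgebra_isAlgebra.Build F free_alg free_scaleAr.

Definition free_x (i : 'I_n) : free_alg := << fmu (inl i) >>.
Definition free_y (i : 'I_n) : free_alg := << fmu (inr i) >>.

Inductive weyl_relator : free_alg -> Prop :=
| Relator_xy i j : weyl_relator (commutator (free_x i) (free_y j) - (i == j)%:R)
| Relator_xx i j : weyl_relator (commutator (free_x i) (free_x j))
| Relator_yy i j : weyl_relator (commutator (free_y i) (free_y j)).

(* The ideal is proper: the free algebra acts on F[X_1, ..., X_n], x_i as the
   i-th partial derivative and y_i as multiplication by X_i, and the ideal acts
   by 0 while 1 does not. *)
Section Action.
Local Notation P := (mpoly.mpoly n F).

Definition letter_act (g : 'I_n + 'I_n) (q : P) : P :=
  match g with
  | inl i => mpoly.mderiv i q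
  | inr i => mpoly.mpolyX F (mpoly.mnm1 i) * q
  end.

Definition word_act (w : seq ('I_n + 'I_n)%type) (q : P) : P := foldr letter_act q w.

Definition weyl_act (f : free_alg) (q : P) : P :=
  mmap (@mpoly.mpolyC n F) (fun w : {fmonom ('I_n + 'I_n)%type} => word_act w q) f.

Lemma letter_act_linear g : linear (letter_act g).
Proof.
case: g => i c q r /=; first by rewrite mpoly.mderivD mpoly.mderivZ.
by rewrite mulrDr -scalerAr.
Qed.

Lemma word_act_linear w : linear (word_act w).
Proof. by move=> c q r; elim: w => //= g w ->; rewrite letter_act_linear. Qed.
HB.instance Definition _ w :=
  GRing.isLinear.Build F P P *:%R (word_act w) (word_act_linear w).

Lemma weyl_actD f g q : weyl_act (f + g) q = weyl_act f q + weyl_act g q.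
Proof. exact: raddfD. Qed.

Lemma weyl_actB f g q : weyl_act (f - g) q = weyl_act f q - weyl_act g q.
Proof. exact: raddfB. Qed.

Lemma weyl_act0 q : weyl_act 0 q = 0. Proof. exact: raddf0. Qed.

Lemma weyl_actU c w q : weyl_act << c *g w >> q = c *: word_act w q.
Proof. by rewrite /weyl_act mmapU mpoly.mul_mpolyC. Qed.

Lemma weyl_act1 q : weyl_act 1 q = q.
Proof. by rewrite (weyl_actU 1 mone) scale1r fm1. Qed.

Lemma weyl_act_linear f : linear (weyl_act f).
Proof.
move=> c q r; rewrite /weyl_act !mmapE scaler_sumr -big_split /=.
by apply: eq_bigr => w _; rewrite linearP mulrDr -scalerAr.
Qed.
HB.instance Definition _ f := GRing.isLinear.Build F P P *:%R (weyl_act f) (weyl_act_linear f).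

Lemma weyl_actM f g q : weyl_act (f * g) q = weyl_act f (weyl_act g q).
Proof.
rewrite malgME {1}/weyl_act raddf_sum [RHS]mmapE; apply: eq_bigr => w _ /=.
rewrite raddf_sum [weyl_act g q]mmapE raddf_sum /= mulr_sumr; apply: eq_bigr => v _.
by rewrite mmapU fmM !mpoly.mul_mpolyC linearZ scalerA /word_act foldr_cat.
Qed.

Lemma weyl_act_x i q : weyl_act (free_x i) q = mpoly.mderiv i q.
Proof. by rewrite weyl_actU scale1r fmU. Qed.

Lemma weyl_act_y i q : weyl_act (free_y i) q = mpoly.mpolyX F (mpoly.mnm1 i) * q.
Proof. by rewrite weyl_actU scale1r fmU. Qed.

Lemma weyl_act_commutator a b q :
  weyl_act (commutator a b) q = weyl_act a (weyl_act b q) - weyl_act b (weyl_act a q).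
Proof. by apply: (etrans (weyl_actB _ _ _)); congr (_ - _); apply: weyl_actM. Qed.

Lemma weyl_act_relator f q : weyl_relator f -> weyl_act f q = 0.
Proof.
case=> i j.
- rewrite weyl_actB weyl_act_commutator !(weyl_act_x, weyl_act_y) mpoly.mderivM addrK.
  rewrite mpoly.mderivX mpoly.mnm1E eq_sym.
  case: (eqVneq i j) => [->|_]; last by rewrite scale0r mul0r sub0r weyl_act0 oppr0.
  have -> : mpoly.mnm_sub (mpoly.mnm1 j) (mpoly.mnm1 j) = mpoly.mnm0.
    by apply/mpoly.mnmP=> k; rewrite mpoly.mnmBE mpoly.mnm0E subnn.
  by rewrite weyl_act1 scale1r mpoly.mpolyX0 mul1r subrr.
- by rewrite weyl_act_commutator !weyl_act_x mpoly.mderiv_comm subrr.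
- by rewrite weyl_act_commutator !weyl_act_y mulrCA subrr.
Qed.

Lemma weyl_act_ideal f q : two_sided_ideal weyl_relator f -> weyl_act f q = 0.
Proof.
move=> If; elim: If q => {f} [r Sr|q|a b _ IHa _ IHb q|a b _ IHb q|a b _ IHa q].
- by move=> q; apply: weyl_act_relator.
- exact: weyl_act0.
- by rewrite weyl_actD IHa IHb addr0.
- by rewrite weyl_actM IHb linear0.
- by rewrite weyl_actM IHa.
Qed.

End Action.

Lemma weyl_proper : ~ two_sided_ideal weyl_relator 1.
Proof. by move=> /(weyl_act_ideal 1)/eqP; rewrite weyl_act1 oner_eq0. Qed.

(* The Weyl algebra A_n over F. *)
Definition weyl : Type := alg_quot weyl_proper.
HB.instance Definition _ := GRing.Algebra.on weyl.

Definition weyl_x (i : 'I_n) : weyl := quot_pi weyl_proper (free_x i).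
Definition weyl_y (i : 'I_n) : weyl := quot_pi weyl_proper (free_y i).

End WeylAlgebra.

(* Main.v *)
From HB Require Import structures.
Require Import Defs.
From mathcomp Require Import all_boot all_algebra.
From mathcomp Require Import mpoly.
From mathcomp Require Import monalg.

Set Implicit Arguments.
Unset Strict Implicit.
Unset Printing Implicit Defensive.

Import GRing.Theory.
Local Open Scope ring_scope.

(** Write [x, y] for the commutator and let 0, 1 be two distinct indices. In
    characteristic p the elements x_i^p and y_i^p are central in A_n, hence so
    is

      c = y_0^p - y_1^p x_0^(p(p-1))           ([kernel_elt]).

    As c is central and the 1-form x_0^(p-1) dx_0 + dx_1 is closed, the assignment

      x_i |-> x_i,   y_0 |-> y_0 + c x_0^(p-1),   y_1 |-> y_1 + c,
      y_i |-> y_i for the other i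

    respects the defining relations ([image_xy], [image_yy]) and extends to an
    endomorphism phi ([weyl_universal]). It sends c to 0. Indeed Frobenius
    gives phi(y_1)^p = y_1^p + c^p, while Jacobson's formula
    ([expr_add_pchar]) adds to y_0^p + c^p x_0^(p(p-1)) the iterated commutator
    of c x_0^(p-1) with y_0, taken p-1 times, which is (p-1)! c = -c by
    Wilson's theorem. So

      phi(c) = phi(y_0)^p - phi(y_1)^p x_0^(p(p-1))
             = (y_0^p + c^p x_0^(p(p-1)) - c) - (y_1^p + c^p) x_0^(p(p-1))
             = c - c = 0.

    Finally c is not zero: when x_i acts on polynomials as the i-th partial
    derivative and y_i as multiplication by X_i, it maps 1 to X_0^p. *)

(** * Iterated commutators *)

Section Commutator.
Variable R : nzRingType.
Implicit Types a b c z w : R.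

Lemma commutator_eq0 a b : GRing.comm a b -> commutator a b = 0.
Proof. by move=> cab; rewrite /commutator cab subrr. Qed.

Lemma comm_commutator a b : commutator a b = 0 -> GRing.comm a b.
Proof. by move=> /eqP; rewrite subr_eq0 => /eqP. Qed.

Lemma commutator_sym a b : commutator a b = - commutator b a.
Proof. by rewrite /commutator opprB. Qed.

Lemma commutatorDr a b c :
  commutator a (b + c) = commutator a b + commutator a c.
Proof. by rewrite /commutator mulrDl mulrDr opprD addrACA. Qed.

Lemma commutator_mull a b c :
  commutator (a * b) c = a * commutator b c + commutator a c * b.
Proof. by rewrite /commutator mulrBr mulrBl !mulrA addrA subrK. Qed.

Lemma commutator_mulC z a b :
  GRing.comm z b -> commutator (z * a) b = z * commutator a b.
Proof. by move=> czb; rewrite commutator_mull (commutator_eq0 czb) mul0r addr0. Qed.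

Lemma commutatorMn a b m : commutator (a *+ m) b = commutator a b *+ m.
Proof. by rewrite /commutator mulrnAl mulrnAr -mulrnBl. Qed.

(** The sign is opposite to that of the usual adjoint map; then, for the
    generators of the Weyl algebra, [ad (y i)] is the derivation with respect
    to [x i]. *)
Definition ad z w := commutator w z.

(** Each factor [z] that [w] is moved across either passes to its left or is
    absorbed into a commutator; the binomial coefficient counts the choices of
    the [k] absorbed factors. *)
Lemma mulr_expr_ad w z n :
  w * z ^+ n =
    \sum_(k < n.+1) (z ^+ (n - k) * iter k (ad z) w) *+ 'C(n, k).
Proof.
elim: n => [|n IHn]; first by rewrite big_ord1 subnn !expr0 mul1r mulr1.
pose D k := iter k (ad z) w.
have DS k : D k * z = z * D k + D k.+1 by rewrite /D /= /ad /commutator addrC subrK.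
transitivity (\sum_(k < n.+1) ((z ^+ (n.+1 - k) * D k) *+ 'C(n, k)
                               + (z ^+ (n - k) * D k.+1) *+ 'C(n, k))).
  rewrite exprSr mulrA IHn mulr_suml; apply: eq_bigr => k _.
  by rewrite mulrnAl -mulrA DS mulrDr mulrA -exprSr -subSn -1?ltnS // mulrnDl.
rewrite big_split /= [RHS]big_ord_recl [in LHS]big_ord_recl /= !bin0.
rewrite !subn0 -addrA; congr (_ + _).
rewrite [RHS]big_ord_recr /= big_ord_recr /= addrA.
rewrite !binn subSS; congr (_ + _).
rewrite -big_split /=; apply: eq_bigr => k _.
by rewrite /bump /= !add1n subSS binS mulrnDr addrC.
Qed.

Lemma commutator_exprl a b m :
  GRing.comm (commutator a b) a ->
  commutator (a ^+ m) b = commutator a b * a ^+ m.-1 *+ m.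
Proof.
move=> cab; elim: m => [|m IHm].
  by rewrite expr0 mulr0n commutator_eq0 //; apply/commr_sym/commr1.
rewrite exprS commutator_mull IHm mulrnAr mulrA -cab -mulrA -exprS /=.
by case: m {IHm} => [|m] /=; rewrite ?mulr0n ?add0r // -mulrSr.
Qed.

Lemma iter_ad_expr a b z m k :
    commutator a b = 1 -> GRing.comm z b ->
  iter k (ad b) (z * a ^+ m) = z * a ^+ (m - k) *+ m ^_ k.
Proof.
move=> ab1 czb; elim: k => [|k IHk]; first by rewrite subn0.
rewrite iterS IHk /ad commutatorMn commutator_mulC // commutator_exprl.
  by rewrite ab1 mul1r mulrnAr -mulrnA mulnC -subnS ffactnSr.
by rewrite ab1; apply/commr_sym/commr1.
Qed.

End Commutator.

Lemma rmorph_commutator (R S : nzRingType) (f : {rmorphism R -> S}) a b :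
  f (commutator a b) = commutator (f a) (f b).
Proof. by rewrite /commutator rmorphB !rmorphM. Qed.

(** * The p-th power of a sum *)

Section PowerDerivative.
Variable R : nzRingType.
Implicit Types u : {poly R}.

(** The Leibniz rule in a noncommutative ring: the factor [u^`()] is moved to
    the right end of each product, and Pascal's rule collects the
    coefficients. *)
Lemma deriv_expr_ad u n :
  (u ^+ n)^`() =
    \sum_(k < n) (u ^+ (n.-1 - k) * iter k (ad u) u^`()) *+ 'C(n, k.+1).
Proof.
elim: n => [|n IHn]; first by rewrite big_ord0 expr0 -polyC1 derivC.
rewrite exprS derivM IHn mulr_expr_ad mulr_sumr /=.
under [X in _ = X]eq_bigr => k _ do rewrite binS addnC mulrnDr.
rewrite big_split /=; congr (_ + _).
rewrite [RHS]big_ord_recr /= bin_small // mulr0n addr0.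
apply: eq_bigr => k _; rewrite mulrnAr mulrA -exprS.
congr ((_ ^+ _ * _) *+ _).
by case: n k {IHn} => [[]//|n] k; rewrite subSn // -ltnS.
Qed.

End PowerDerivative.

Lemma size_expr_affine (R : nzRingType) (u : {poly R}) n :
  (size u <= 2)%N -> (size (u ^+ n) <= n.+1)%N.
Proof.
move=> su; apply: leq_trans (size_poly_exp_leq _ _) _; rewrite ltnS.
by case: (size u) su => [|[|[|//]]] //= _; rewrite mul1n.
Qed.

Lemma coef_expr_top (R : nzRingType) (u : {poly R}) n :
  (size u <= 2)%N -> (u ^+ n)`_n = u`_1 ^+ n.
Proof.
move=> su; elim: n => [|n IHn]; first by rewrite !expr0 coef1.
have sun := size_expr_affine n su.
rewrite exprS coefM 2!big_ord_recl /= subn0 [(u ^+ n)`_n.+1]nth_default //.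
rewrite mulr0 add0r /bump subSS subn0 IHn big1 ?addr0 ?exprS // => j _.
by rewrite nth_default ?mul0r // (leq_trans su).
Qed.

Section CharP.
Variables (F : fieldType) (p : nat).
Hypothesis hp : p \in [pchar F].

Let p_pr : prime p. Proof. exact: pcharf_prime hp. Qed.
Let p_gt0 : (0 < p)%N. Proof. exact: prime_gt0. Qed.

Lemma pchar_alg (B : algType F) : p \in [pchar B].
Proof. by rewrite inE p_pr /= -scaler_nat (pcharf0 hp) scale0r. Qed.

Lemma natr_fact_pred (B : algType F) : (p.-1)`!%:R = -1 :> B.
Proof.
apply/eqP; rewrite -subr_eq0 opprK natr1 -(dvdn_pcharf (pchar_alg B)).
by rewrite -Wilson // prime_gt1.
Qed.

(** In [deriv_expr_ad] only the binomial coefficient of index [p] survives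
    modulo [p]. *)
Lemma deriv_exp_pchar (B : algType F) (u : {poly B}) :
  (u ^+ p)^`() = iter p.-1 (ad u) u^`().
Proof.
have hP : p \in [pchar {poly B}].
  by rewrite inE p_pr /= -polyC_natr (pcharf0 (pchar_alg B)).
rewrite deriv_expr_ad -(prednK p_gt0) big_ord_recr /= subnn mul1r binn.
rewrite big1 ?add0r // => k _.
suff /dvdnP [m ->] : (p %| 'C(p.-1.+1, k.+1))%N.
  by rewrite mulnC mulrnA (mulrn_pchar hP) mul0rn.
by rewrite (prednK p_gt0) prime_dvd_bin //= -{2}(prednK p_gt0) ltnS.
Qed.

(** Jacobson's formula when [g] commutes with its iterated commutators with
    [y]. With an indeterminate [T], the derivative of [(y + g T) ^+ p] in [T]
    is then the constant [iter p.-1 (ad y) g]; this fixes the coefficients of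
    degree [1] to [p - 1], those of degree [0] and [p] are [y ^+ p] and
    [g ^+ p], and [T = 1] gives the formula. *)
Lemma expr_add_pchar (B : algType F) (y g : B) :
    (forall k, GRing.comm (iter k (ad y) g) g) ->
  (y + g) ^+ p = y ^+ p + g ^+ p + iter p.-1 (ad y) g.
Proof.
move=> cg; pose u := y%:P + g%:P * 'X.
have ad_u k : iter k (ad u) g%:P = (iter k (ad y) g)%:P.
  elim: k => //= k ->; set w := iter k (ad y) g.
  rewrite /ad commutatorDr (@commutator_eq0 _ _ (g%:P * 'X)) ?addr0.
    by rewrite /commutator -!polyCM -polyCB.
  apply: commrM; last exact: commr_polyX.
  by rewrite /GRing.comm -!polyCM cg.
have du : u^`() = g%:P by rewrite derivD derivM !derivC derivX mul0r !add0r mulr1.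
have coef_u i : (u ^+ p)`_i.+1 *+ i.+1 = (iter p.-1 (ad y) g)%:P`_i.
  by rewrite -coef_deriv deriv_exp_pchar du ad_u.
have su : (size u <= 2)%N.
  apply: leq_trans (size_polyD _ _) _; rewrite geq_max.
  rewrite (leq_trans (size_polyC_leq1 _)) //=.
  apply: leq_trans (size_polyMleq _ _) _; rewrite size_polyX addn2 /=.
  by rewrite ltnS size_polyC_leq1.
have u0 : u`_0 = y by rewrite coefD coefC coefMX /= addr0.
have u1 : u`_1 = g by rewrite coefD coefC coefMX coefC /= add0r.
have c0 : (u ^+ p)`_0 = y ^+ p.
  by elim: p => [|m IHm]; rewrite ?expr0 ?coef1 // !exprS coef0M u0 IHm.
have c1 : (u ^+ p)`_1 = iter p.-1 (ad y) g by rewrite -[LHS]mulr1n coef_u coefC.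
have cmid i : (1 < i < p)%N -> (u ^+ p)`_i = 0.
  case: i => [|[|i]] // /andP [_ lt_ip].
  have := coef_u i.+1; rewrite coefC /= -scaler_nat => /eqP.
  rewrite scaler_eq0 => /orP [|/eqP //].
  by rewrite -(dvdn_pcharf hp) gtnNdvd.
have -> : y + g = u.[1] by rewrite /u hornerD hornerMX !hornerC mulr1.
rewrite -horner_exp_comm; last by rewrite /comm_poly mul1r mulr1.
rewrite (horner_coef_wide _ (size_expr_affine p su)).
under eq_bigr do rewrite expr1n mulr1.
rewrite big_ord_recr /= coef_expr_top // u1 addrAC; congr (_ + _).
rewrite -(big_mkord xpredT (fun i => (u ^+ p)`_i)) big_ltn //.
rewrite big_ltn ?prime_gt1 // c0 c1 big_nat big1 ?addr0 //.
Qed.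

End CharP.

(** * The universal property of the Weyl algebra *)

Section Universal.
Variables (F : fieldType) (n : nat) (B : algType F) (X Y : 'I_n -> B).
Hypothesis XY : forall i j, commutator (X i) (Y j) = (i == j)%:R.
Hypothesis XX : forall i j, GRing.comm (X i) (X j).
Hypothesis YY : forall i j, GRing.comm (Y i) (Y j).

Definition letter_val (g : 'I_n + 'I_n) : B :=
  match g with inl i => X i | inr i => Y i end.

Definition word_val (w : {fmonom ('I_n + 'I_n)%type}) : B :=
  \prod_(g <- w : seq _) letter_val g.

Lemma word_val_mmorphism : monalg.mmorphism word_val.
Proof.
split=> [v w|]; first by rewrite /word_val fmM big_cat.
by rewrite /word_val fm1 big_nil.
Qed.
HB.instance Definition _ := isMultiplicative.Build _ B word_val word_val_mmorphism.

Definition free_lift (f : free_alg F n) : B := mmap (in_alg B) word_val f.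

Lemma free_lift_zmod_morphism : zmod_morphism free_lift.
Proof. exact: raddfB. Qed.
HB.instance Definition _ :=
  GRing.isZmodMorphism.Build (free_alg F n) B free_lift free_lift_zmod_morphism.

Lemma free_lift_monoid_morphism : monoid_morphism free_lift.
Proof.
have c_alg (g : {malg F[{fmonom ('I_n + 'I_n)%type}]}) m m' :
    GRing.comm (in_alg B (monalg.mcoeff m g)) (word_val m').
  by rewrite /GRing.comm /= mulr_algl mulr_algr.
by have [fM f1] := commr_mmap_is_multiplicative c_alg; split.
Qed.
HB.instance Definition _ :=
  GRing.isMonoidMorphism.Build (free_alg F n) B free_lift free_lift_monoid_morphism.

Lemma free_lift_scalable : scalable free_lift.
Proof. by move=> c f; rewrite /free_lift mmapZ /= mulr_algl. Qed.

Lemma free_lift_x i : free_lift (free_x F i) = X i.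
Proof. by rewrite /free_lift mmapU /= scale1r mul1r /word_val fmU big_seq1. Qed.

Lemma free_lift_y i : free_lift (free_y F i) = Y i.
Proof. by rewrite /free_lift mmapU /= scale1r mul1r /word_val fmU big_seq1. Qed.

Lemma free_lift_commutator (a b : free_alg F n) :
  free_lift (commutator a b) = commutator (free_lift a) (free_lift b).
Proof. exact: (rmorph_commutator free_lift). Qed.

Lemma free_lift_ideal f : two_sided_ideal (@weyl_relator F n) f -> free_lift f = 0.
Proof.
elim=> {f} [_ [] i j||a b _ IHa _ IHb|a b _ IHb|a b _ IHa].
- rewrite rmorphB /= free_lift_commutator free_lift_x free_lift_y XY.
  by rewrite rmorph_nat subrr.
- by rewrite free_lift_commutator !free_lift_x commutator_eq0.
- by rewrite free_lift_commutator !free_lift_y commutator_eq0.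
- exact: raddf0.
- by rewrite rmorphD /= IHa IHb addr0.
- by rewrite rmorphM /= IHb mulr0.
- by rewrite rmorphM /= IHa mul0r.
Qed.

Definition weyl_lift (u : weyl F n) : B :=
  free_lift (quot_repr (S_proper := @weyl_proper F n) u).

Lemma weyl_lift_pi f : weyl_lift (quot_pi (@weyl_proper F n) f) = free_lift f.
Proof.
apply/eqP; rewrite -subr_eq0 -rmorphB; apply/eqP/free_lift_ideal.
exact/ideal_predP/quot_pi_repr.
Qed.

Lemma weyl_lift_zmod_morphism : zmod_morphism weyl_lift.
Proof.
move=> u v; rewrite -[u]quot_reprK -[v]quot_reprK -raddfB !weyl_lift_pi.
exact: raddfB.
Qed.
HB.instance Definition _ :=
  GRing.isZmodMorphism.Build (weyl F n) B weyl_lift weyl_lift_zmod_morphism.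

Lemma weyl_lift_monoid_morphism : monoid_morphism weyl_lift.
Proof.
split=> [|u v]; first by rewrite [LHS]weyl_lift_pi rmorph1.
rewrite -[u]quot_reprK -[v]quot_reprK -rmorphM !weyl_lift_pi; exact: rmorphM.
Qed.
HB.instance Definition _ :=
  GRing.isMonoidMorphism.Build (weyl F n) B weyl_lift weyl_lift_monoid_morphism.

Lemma weyl_lift_scalable : scalable weyl_lift.
Proof.
move=> c u; rewrite -[u]quot_reprK -quot_pi_scalable !weyl_lift_pi.
exact: free_lift_scalable.
Qed.
HB.instance Definition _ :=
  GRing.isScalable.Build F (weyl F n) B *:%R weyl_lift weyl_lift_scalable.

Lemma weyl_lift_x i : weyl_lift (weyl_x F i) = X i.
Proof. by rewrite weyl_lift_pi free_lift_x. Qed.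

Lemma weyl_lift_y i : weyl_lift (weyl_y F i) = Y i.
Proof. by rewrite weyl_lift_pi free_lift_y. Qed.

(** The morphism is provided existentially since its structure depends on the
    proofs of the relations, which unification cannot recover from
    [weyl_lift]. *)
Lemma weyl_universal :
  exists phi : {lrmorphism weyl F n -> B},
    (forall i, phi (weyl_x F i) = X i) /\ (forall i, phi (weyl_y F i) = Y i).
Proof. by exists weyl_lift; split=> i; [apply: weyl_lift_x|apply: weyl_lift_y]. Qed.

End Universal.

Section QuotientRelations.
Variables (F : fieldType) (A : algType F) (S : A -> Prop).
Variable S_proper : ~ two_sided_ideal S 1.
Local Notation pi := (quot_pi S_proper).

Lemma quot_pi_eq0 f : S f -> pi f = 0.
Proof.
move=> Sf; rewrite -(raddf0 pi); apply/quot_piP.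
by rewrite subr0; apply/ideal_predP/Ideal_gen.
Qed.

Lemma quot_pi_commutator a b : commutator (pi a) (pi b) = pi (commutator a b).
Proof. by rewrite (rmorph_commutator pi). Qed.

Lemma quot_pi_comm a b : S (commutator a b) -> GRing.comm (pi a) (pi b).
Proof.
move=> Sab; apply/eqP; rewrite -subr_eq0; apply/eqP.
by rewrite -[LHS]/(commutator _ _) quot_pi_commutator quot_pi_eq0.
Qed.

Lemma quot_pi_commutator_nat a b m :
  S (commutator a b - m%:R) -> commutator (pi a) (pi b) = m%:R.
Proof.
move=> Sab; apply/eqP; rewrite -subr_eq0 quot_pi_commutator.
by rewrite -(rmorph_nat pi) -rmorphB /= quot_pi_eq0.
Qed.

End QuotientRelations.

Section WeylRelations.
Variables (F : fieldType) (n : nat).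
Local Notation x := (@weyl_x F n).
Local Notation y := (@weyl_y F n).

Lemma weyl_xy i j : commutator (x i) (y j) = (i == j)%:R.
Proof. exact: (quot_pi_commutator_nat (@weyl_proper F n) (Relator_xy F i j)). Qed.

Lemma weyl_xx i j : GRing.comm (x i) (x j).
Proof. exact: (quot_pi_comm (@weyl_proper F n) (Relator_xx F i j)). Qed.

Lemma weyl_yy i j : GRing.comm (y i) (y j).
Proof. exact: (quot_pi_comm (@weyl_proper F n) (Relator_yy F i j)). Qed.

End WeylRelations.

(** * A central element and the endomorphism that kills it *)

Section NonInjective.
Variables (F : fieldType) (p n : nat).
Hypothesis hp : p \in [pchar F].
Variables i0 i1 : 'I_n.
Hypothesis i01 : i0 != i1.

(* The computation uses only the defining relations, so it is carried out in
   any algebra with elements that satisfy them. *)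
Variables (A : algType F) (x y : 'I_n -> A).
Hypothesis xy_rel : forall i j, commutator (x i) (y j) = (i == j)%:R.
Hypothesis xx_rel : forall i j, GRing.comm (x i) (x j).
Hypothesis yy_rel : forall i j, GRing.comm (y i) (y j).

Let p_pr : prime p. Proof. exact: pcharf_prime hp. Qed.
Let p_gt0 : (0 < p)%N. Proof. exact: prime_gt0. Qed.
Let hpA : p \in [pchar A]. Proof. exact: pchar_alg. Qed.

Lemma xp_comm_y i j : GRing.comm (x i ^+ p) (y j).
Proof.
apply: comm_commutator; rewrite commutator_exprl ?mulrn_pchar //.
by rewrite xy_rel; apply/commr_sym/commr_nat.
Qed.

Lemma yp_comm_x i j : GRing.comm (y i ^+ p) (x j).
Proof.
apply: comm_commutator; rewrite commutator_exprl ?mulrn_pchar //.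
by rewrite commutator_sym xy_rel; apply/commr_sym/commrN/commr_nat.
Qed.

(** The factor [x i0] stands on the right so that in [weyl_act_kernel_elt] the
    second term kills [1] at once. *)
Definition kernel_elt : A :=
  y i0 ^+ p - y i1 ^+ p * (x i0 ^+ p) ^+ p.-1.
Local Notation c := kernel_elt.

Lemma kernel_elt_x j : GRing.comm c (x j).
Proof.
apply/commr_sym/commrB; first exact/commr_sym/yp_comm_x.
apply: commrM; first exact/commr_sym/yp_comm_x.
by do 2!apply: commrX; apply: xx_rel.
Qed.

Lemma kernel_elt_y j : GRing.comm c (y j).
Proof.
apply/commr_sym/commrB; first exact/commrX/yy_rel.
apply: commrM; first exact/commrX/yy_rel.
exact/commrX/commr_sym/xp_comm_y.
Qed.

Definition twist j : A :=
  if j == i0 then x i0 ^+ p.-1 else (j == i1)%:R.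
Definition image_y j : A := y j + c * twist j.

Lemma twist_x i j : GRing.comm (x i) (twist j).
Proof.
by rewrite /twist; case: ifP => _; [apply/commrX/xx_rel|apply: commr_nat].
Qed.

Lemma twist_y i j : i != j -> GRing.comm (y i) (twist j).
Proof.
rewrite /twist; case: ifP => [/eqP->|_] ij; last exact: commr_nat.
apply/commrX/commr_sym/comm_commutator.
by rewrite xy_rel eq_sym (negPf ij).
Qed.

Lemma twist_twist i j : GRing.comm (twist i) (twist j).
Proof.
rewrite /twist; case: (i == i0); last exact/commr_sym/commr_nat.
by case: (j == i0); [|apply: commr_nat].
Qed.

Lemma kernel_elt_twist j : GRing.comm c (twist j).
Proof.
by rewrite /twist; case: ifP => _; [apply/commrX/kernel_elt_x|apply: commr_nat].
Qed.

Lemma image_xy i j : commutator (x i) (image_y j) = (i == j)%:R.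
Proof.
rewrite commutatorDr xy_rel commutator_eq0 ?addr0 //.
by apply: commrM; [apply/commr_sym/kernel_elt_x|apply: twist_x].
Qed.

(** For [i != j] every cross commutator vanishes, as [twist j] involves no
    generator other than [x j]. *)
Lemma image_yy i j : GRing.comm (image_y i) (image_y j).
Proof.
have [->//|ij] := eqVneq i j.
have y_ct k l : k != l -> GRing.comm (y k) (c * twist l).
  by move=> kl; apply: commrM; [apply/commr_sym/kernel_elt_y|apply: twist_y].
have c_ct k : GRing.comm c (c * twist k).
  by apply: commrM => //; apply: kernel_elt_twist.
have ct_ct k l : GRing.comm (c * twist k) (c * twist l).
  apply/commr_sym/commrM; first exact/commr_sym/c_ct.
  apply/commr_sym/commrM; last exact: twist_twist.
  exact/commr_sym/kernel_elt_twist.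
apply: commrD.
  apply/commr_sym/commrD; first exact: yy_rel.
  by apply: y_ct; rewrite eq_sym.
by apply/commr_sym/commrD; [apply/commr_sym/y_ct|apply: ct_ct].
Qed.

(** Differentiating [c * x i0 ^+ p.-1] [p.-1] times with respect to [x i0] leaves
    [c] times the factorial of [p.-1], which is [- c]. *)
Lemma image_y0_exp :
  image_y i0 ^+ p = y i0 ^+ p + c ^+ p * (x i0 ^+ p) ^+ p.-1 - c.
Proof.
have x_c m : GRing.comm (x i0 ^+ m) c by apply/commr_sym/commrX/kernel_elt_x.
rewrite /image_y /twist eqxx (expr_add_pchar hp) => [|k].
  rewrite iter_ad_expr ?xy_rel ?eqxx //; last exact: kernel_elt_y.
  rewrite subnn expr0 mulr1 ffactnn exprMn_comm; last exact/commr_sym/x_c.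
  by rewrite exprAC -mulr_natr natr_fact_pred // mulrN1.
rewrite iter_ad_expr ?xy_rel ?eqxx //; last exact: kernel_elt_y.
apply/commr_sym/commrMn/commrM; apply/commr_sym/commrM => //.
  exact/commr_sym/x_c.
by rewrite /GRing.comm -!exprD addnC.
Qed.

Lemma image_y1_exp : image_y i1 ^+ p = y i1 ^+ p + c ^+ p.
Proof.
rewrite /image_y /twist eq_sym (negPf i01) eqxx mulr1.
exact: (pFrobenius_autD_comm hpA (commr_sym (kernel_elt_y i1))).
Qed.

Lemma kernel_elt_mapsto0 (phi : {rmorphism A -> A}) :
    (forall i, phi (x i) = x i) -> (forall i, phi (y i) = image_y i) ->
  phi c = 0.
Proof.
move=> phix phiy.
rewrite {1}/kernel_elt rmorphB rmorphM !rmorphXn /= !phix !phiy.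
rewrite image_y0_exp image_y1_exp mulrDl addrAC opprD addrACA subrr addr0.
exact: subrr.
Qed.

End NonInjective.

(** * The central element is not zero *)

Section WeylAction.
Variables (F : fieldType) (n : nat).
Local Notation P := (mpoly.mpoly n F).
Local Notation X i := (mpoly.mpolyX F (mnm1 i)).

Lemma weyl_act_y_exp i m q :
  weyl_act (free_y F i ^+ m) q = X i ^+ m * q :> P.
Proof.
elim: m => [|m IHm]; first by rewrite !expr0 weyl_act1 mul1r.
by rewrite !exprS weyl_actM weyl_act_y IHm mulrA.
Qed.

Lemma weyl_act_x_exp i m :
  (0 < m)%N -> weyl_act (free_x F i ^+ m) 1 = 0 :> P.
Proof.
case: m => // m _; rewrite exprSr weyl_actM weyl_act_x.
by rewrite -mpolyC1 mderivC linear0.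
Qed.

Lemma weyl_act_kernel_elt p i0 i1 :
  (1 < p)%N ->
  weyl_act (kernel_elt p i0 i1 (@free_x F n) (@free_y F n)) 1
    = X i0 ^+ p :> P.
Proof.
move=> p_gt1; rewrite /kernel_elt weyl_actB weyl_actM -exprM weyl_act_x_exp.
  have act0 f : weyl_act f 0 = 0 :> P by apply: raddf0.
  apply: etrans (congr2 (fun a b => a - b) (weyl_act_y_exp i0 p 1) (act0 _)) _.
  by rewrite subr0 mulr1.
by rewrite muln_gt0 (ltnW p_gt1) -subn1 subn_gt0.
Qed.

End WeylAction.

(** This lifts the central element to the free algebra, where the action on
    polynomials is defined. *)
Lemma rmorph_kernel_elt (F : fieldType) (A B : algType F)
    (h : {rmorphism A -> B}) p n (i0 i1 : 'I_n) (x y : 'I_n -> A) :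
  h (kernel_elt p i0 i1 x y) = kernel_elt p i0 i1 (h \o x) (h \o y).
Proof. by rewrite /kernel_elt rmorphB rmorphM !rmorphXn. Qed.

Lemma weyl_kernel_elt_neq0 (F : fieldType) n p (i0 i1 : 'I_n) :
  (1 < p)%N -> kernel_elt p i0 i1 (@weyl_x F n) (@weyl_y F n) <> 0.
Proof.
move=> p_gt1.
have <- := rmorph_kernel_elt (quot_pi (@weyl_proper F n)) p i0 i1
  (@free_x F n) (@free_y F n).
move=> pi_c0.
have /ideal_predP/(weyl_act_ideal 1) : kernel_elt p i0 i1 (@free_x F n) (@free_y F n) - 0
    \in ideal_pred (@weyl_relator F n).
  by apply/(quot_piP (@weyl_proper F n)); rewrite pi_c0 raddf0.
rewrite subr0 weyl_act_kernel_elt //.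
move=> /(congr1 (mpoly.mcoeff (mnm1 i0 *+ p)%MM)).
by rewrite mcoeffXn eqxx mpoly.mcoeff0 => /eqP; rewrite oner_eq0.
Qed.

Theorem mainTheorem3 (F : fieldType) (p : nat) (hp : p \in [pchar F])
    (n : nat) (hn : (1 < n)%N) :
  exists phi : {lrmorphism weyl F n -> weyl F n}, ~ injective phi.
Proof.
pose i0 := Ordinal (ltnW hn); pose i1 := Ordinal hn.
have i01 : i0 != i1 by [].
pose x := @weyl_x F n; pose y := @weyl_y F n.
have xy := @weyl_xy F n; have xx := @weyl_xx F n; have yy := @weyl_yy F n.
have [phi [phix phiy]] := weyl_universal (image_xy hp i0 i1 xy xx) xx
  (image_yy hp i0 i1 xy xx yy).
exists phi => phi_inj.
apply: (@weyl_kernel_elt_neq0 F n p i0 i1); first exact/prime_gt1/(pcharf_prime hp).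
apply: phi_inj; rewrite raddf0.
exact: (kernel_elt_mapsto0 hp i01 xy xx yy phix phiy).
Qed.
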